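(* For every integer $n\ge 2$, the number of permutations of $[n]=\{1,2,\ldots,n\}$ that avoid the barred pattern $\bar{1}43\bar{5}2$ equals $$ B_{n-1} + 1 + 2^{n-2}-n + \sum_{a=0}^{n-3}\sum_{b=0}^{a-1}\sum_{k=0}^{a-b} \left(\sum_{i=0}^{k} \binom{n - 4 - a + k - i}{k - i}(i+2)^b - \binom{n - 3 - a + k}{k}\right) \genfrac{\{}{\}}{0pt}{}{a-b}{k} + \sum_{a=0}^{n-2}\sum_{k=0}^{n-2-a}\binom{k + a + 1}{k + 1}\genfrac{\{}{\}}{0pt}{}{n-2-a}{k}. $$
   Context: A permutation $\pi$ of $[n]$ is written as the word $\pi(1)\pi(2)\cdots\pi(n)$. It avoids the barred pattern $\bar{1}43\bar{5}2$ if each instance of a (not necessarily consecutive) $432$ pattern in $\pi$ is part of a $14352$ pattern in $\pi$, with its three entries playing the roles of $4$, $3$, $2$. Explicitly: for all positions $p<q<r$ with $\pi(p)>\pi(q)>\pi(r)$, there exist a position $s<p$ with $\pi(s)<\pi(r)$ and a position $t$ with $q<t<r$ and $\pi(t)>\pi(p)$. Notation: $B_m$ is the $m$-th Bell number (the number of set partitions of an $m$-element set). $\genfrac{\{}{\}}{0pt}{}{m}{k}$ is the Stirling number of the second kind (the number of partitions of an $m$-element set into $k$ nonempty blocks), with $\genfrac{\{}{\}}{0pt}{}{0}{0}=1$ and $\genfrac{\{}{\}}{0pt}{}{m}{0}=0$ for $m\ge 1$. Empty sums (upper limit less than lower limit) are $0$. Binomial coefficients $\binom{x}{j}$ with integer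 $x$ and integer $j\ge 0$ are $x(x-1)\cdots(x-j+1)/j!$; in particular $\binom{-1}{0}=1$. *)

(* Defs.v *)
From mathcomp Require Import all_boot all_order all_algebra all_fingroup.

Set Implicit Arguments.
Unset Strict Implicit.
Unset Printing Implicit Defensive.

Import GRing.Theory.

(* A permutation of {1, ..., n} is an element of 'S_n, i.e. positions and
   values are shifted down by one, which does not affect pattern avoidance. *)
Definition avoids_bar1_43_bar5_2 (n : nat) (pi : 'S_n) : bool :=
  [forall p : 'I_n, forall q : 'I_n, forall r : 'I_n,
    [&& (p < q)%N, (q < r)%N, (pi p > pi q)%N & (pi q > pi r)%N] ==>
    [exists s : 'I_n, (s < p)%N && (pi s < pi r)%N] &&
    [exists t : 'I_n, [&& (q < t)%N, (t < r)%N & (pi t > pi p)%N]]].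

Definition bell (m : nat) : nat :=
  #|[set P : {set {set 'I_m}} | partition P [set: 'I_m]]|.

(* [partition] requires the blocks to be nonempty. *)
Definition stirling2 (m k : nat) : nat :=
  #|[set P : {set {set 'I_m}} | partition P [set: 'I_m] & #|P| == k]|.

(* x (x - 1) ... (x - j + 1) / j! for an integer x; the division is exact. *)
Definition binz (x : int) (j : nat) : int :=
  ((\prod_(0 <= l < j) (x - l%:Z))%R %/ (j`!)%:Z)%Z.

(* Main.v *)
Require Import Defs.
From mathcomp Require Import all_boot all_order all_algebra all_fingroup zify.

Set Implicit Arguments.
Unset Strict Implicit.
Unset Printing Implicit Defensive.

(** Call the left-to-right maxima of a permutation its records.  The avoidance
condition has two halves, one for the role of 5 and one for the role of 1.

The half on 5 says that, after an entry that is not a record, the entries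
increase up to the next record (lemma [separated_between]).  Such a permutation
is cut by its records into blocks, each a record followed by an increasing run
of smaller entries; as the blocks are ordered by their maxima, it is a set
partition.  Label every value by the number of records to the right of it, so
that the blocks are numbered from right to left.  Building the permutation by
inserting smaller and smaller values, a new smallest value is put in front,
where it opens a new block, or directly after a record, where it joins the
block of that record.  Hence reading the labels from the largest value down is
a bijection onto the restricted growth words (lemma [sum_separated]), which are
counted by the Stirling numbers.

The half on 1 is then a condition on that word (lemma [avoids_word_ok]).  Let m
be the first entry.  If m is the smallest value, it plays the role of 1 in all
patterns and there is nothing to check; this gives the Bell number.  Otherwise
the values below m must occur in increasing order, hence their labels decrease
weakly from the label K of the smallest value to the label e of m - 1; and a
value b > m that is not a record and has a larger entry to the left of the
smallest value must have a label at most e, because otherwise b and m - 1 would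
be the 3 and the 2 of a pattern whose 4 precedes all values below m.

To count these words, read them from the smallest value up.  The weakly
decreasing chain from K to e is a weak composition of K - e.  Then, between m
and the record with label K, each of b values is either a record or has one of
the e + 1 labels 0, ..., e, which gives (e + 2)^b.  The values above the record
with label K form an arbitrary set partition into K blocks.  The lemmas
[sum_word_ok], [count_lowS] and [count_highS] are this reading as recurrences,
[count_lowE] and [count_highE] solve them, and a hockey-stick summation
(lemma [sum_block_total]) brings the result to the closed form.

Positions and values are counted from 0. *)

(** * Set partitions and Stirling numbers *)

Section SetPartitions.
Variable T : finType.
Implicit Types (x : T) (B D : {set T}) (P Q : {set {set T}}).

Lemma setD1_notin (U : finType) (a : U) (A : {set U}) : a \notin A -> A :\ a = A.
Proof. by move=> aA; apply/setDidPl; rewrite disjoint_sym disjoints1. Qed.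

Definition num_partitions D k := #|[set P | partition P D & #|P| == k]|.

(** The empty set as [p.2] stands for leaving [x] alone in its block; this turns
the two cases of the Stirling recurrence into one formula. *)
Definition insert_block x (p : {set {set T}} * {set T}) :=
  (x |: p.2) |: (p.1 :\ p.2).

Definition remove_point x Q :=
  let B := pblock Q x :\ x in ((B |: (Q :\ pblock Q x)) :\ set0, B).

(** The last condition fixes the number of blocks after the insertion of a
point, which exceeds [#|p.1|] exactly when the point stays alone. *)
Definition pointed_partitions D k := [set p : {set {set T}} * {set T} |
  [&& partition p.1 D, p.2 \in set0 |: p.1 & #|p.1| + (p.2 == set0) == k]].

(** With [remove_pointP]: inserting [x] is a bijection from the pointed
partitions of [D] to the partitions of [x |: D]. *)
Lemma insert_blockP x D k p : x \notin D -> p \in pointed_partitions D k ->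
  [/\ partition (insert_block x p) (x |: D), #|insert_block x p| = k
    & remove_point x (insert_block x p) = p].
Proof.
case: p => P B xD; rewrite inE /= => /and3P[pP BP /eqP<-].
have P0 : set0 \notin P by rewrite (partition0 pP).
have BD : B \subset D.
  by case/setU1P: BP => [->|/(partitionS pP)//]; rewrite sub0set.
have xB : x \notin B by apply: contra xD; apply: (subsetP BD).
have pPB : partition (P :\ B) (D :\: B).
  case/setU1P: BP => [->|]; last exact: partitionD1.
  by rewrite setD0 setD1_notin.
have xPB C : C \in P -> x \notin C.
  by move/(partitionS pP)/subsetP => CD; apply: contra xD => /CD.
have nU : (x |: B) \notin P :\ B.
  by apply/negP; rewrite inE => /andP[_ /xPB]; rewrite setU11.
have pU : partition (insert_block x (P, B)) (x |: D).
  have -> : x |: D = (x |: B) :|: (D :\: B).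
    by rewrite -setUA -{1}(setIidPr BD) setID.
  apply: partitionU1 => //; first by apply/set0Pn; exists x; rewrite setU11.
  rewrite -setI_eq0 -subset0; apply/subsetP => y; rewrite !inE.
  by case: eqP => [->|_]; rewrite /= ?(negPf xD) ?andbF //; case: (y \in B).
have Epb : pblock (insert_block x (P, B)) x = x |: B.
  by apply: def_pblock; rewrite ?(partition_trivIset pU) ?setU11.
split=> //.
  rewrite /insert_block /= cardsU1 nU.
  case/setU1P: BP => [->|BP]; first by rewrite eqxx setD1_notin // addnC.
  by rewrite [#|P|](cardsD1 B) BP (negPf (partition_neq0 pP BP)) addn0.
rewrite /remove_point Epb; congr (_, _); last first.
  by rewrite setU1K.
rewrite setU1K // /insert_block /= setU1K //.
apply/setP => C; rewrite !inE.
case: (eqVneq C B) => [->|CB] /=.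
  by case/setU1P: BP => [->|BP]; rewrite ?eqxx ?(negPf P0) // BP (partition_neq0 pP BP).
by case CP: (C \in P); rewrite ?andbF // (partition_neq0 pP CP).
Qed.

Lemma remove_pointP x D k Q : x \notin D ->
    partition Q (x |: D) -> #|Q| = k ->
  remove_point x Q \in pointed_partitions D k /\ insert_block x (remove_point x Q) = Q.
Proof.
move=> xD pQ <-; set C := pblock Q x.
have tQ := partition_trivIset pQ.
have xQ : x \in cover Q by rewrite (cover_partition pQ) setU11.
have CQ : C \in Q by apply: pblock_mem.
have xC : x \in C by rewrite mem_pblock.
have Q0 : set0 \notin Q by rewrite (partition0 pQ).
have pQC : partition (Q :\ C) ((x |: D) :\: C) by apply: partitionD1.
have CD : C \subset x |: D by apply: partitionS pQ CQ.
have nC : C :\ x \notin Q :\ C.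
  rewrite in_setD1; apply/negP => /andP[ne CxQ].
  have [E|/set0Pn[y yC]] := eqVneq (C :\ x) set0; first by rewrite -E CxQ in Q0.
  have := def_pblock tQ CxQ yC; move: (yC); rewrite inE => /andP[_ yC'].
  by rewrite (def_pblock tQ CQ yC') => E; rewrite -E eqxx in ne.
rewrite /remove_point -/C; set B := C :\ x; set P := B |: Q :\ C.
have [B0|Bn0] := eqVneq B set0.
  have EP : P :\ set0 = Q :\ C.
    by rewrite /P B0 setU1K // !inE (negPf Q0) andbF.
  have EC : C = [set x] by rewrite -(setD1K xC) -/B B0 setU0.
  split; last by rewrite /insert_block /= EP B0 setU0 -EC setD1_notin ?setD1K //
     !inE (negPf Q0) andbF.
  rewrite inE /= EP B0 eqxx setU11 [#|Q|](cardsD1 C) CQ addnC eqxx /= !andbT.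
  by move: pQC; rewrite {2}EC setU1K.
have EP : P :\ set0 = P.
  by rewrite setD1_notin // !inE eq_sym (negPf Bn0) (negPf Q0) andbF.
split; last first.
  by rewrite /insert_block /= EP /P setU1K // /B setD1K // setD1K.
rewrite inE /= EP (negPf Bn0) !inE eqxx orbT addn0 /P cardsU1 nC [#|Q|](cardsD1 C) CQ.
rewrite eqxx andbT andbT.
have -> : D = B :|: ((x |: D) :\: C).
  apply/setP => y; rewrite !inE; have [->|yx] /= := eqVneq y x.
    by rewrite xC (negPf xD).
  by case yC: (y \in C) => //=; have := subsetP CD _ yC; rewrite !inE (negPf yx).
apply: partitionU1 => //.
rewrite -setI_eq0 -subset0; apply/subsetP => y; rewrite !inE.
by case: (y \in C); rewrite ?andbF.
Qed.

(** The point [x] is alone, or it joins one of the [k.+1] blocks of a partition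
of [D]. *)
Lemma num_partitionsS x D k : x \notin D ->
  num_partitions (x |: D) k.+1 = num_partitions D k + k.+1 * num_partitions D k.+1.
Proof.
move=> xD; rewrite /num_partitions.
have -> : [set Q | partition Q (x |: D) & #|Q| == k.+1]
          = insert_block x @: pointed_partitions D k.+1.
  apply/setP => Q; rewrite inE; apply/andP/imsetP => [[pQ /eqP cQ]|[p pD ->]].
    by have [H E] := remove_pointP xD pQ cQ; exists (remove_point x Q).
  by have [? -> _] := insert_blockP xD pD.
rewrite card_in_imset; last first.
  apply: (can_in_inj (g := remove_point x)) => p pD.
  by have [] := insert_blockP xD pD.
set Z := [set p : {set {set T}} * {set T} | p.2 == set0].
rewrite -(cardsID Z (pointed_partitions D k.+1)); congr (_ + _).
  have -> : pointed_partitions D k.+1 :&: Z =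
            setX [set P | partition P D & #|P| == k] [set set0].
    apply/setP => -[P B]; rewrite !inE /=; case: (eqVneq B set0) => [->|];
      by rewrite ?andbF /= ?addn1 ?eqSS ?andbT.
  by rewrite cardsX cards1 muln1.
rewrite -sum1_card (eq_bigl (fun p : {set {set T}} * {set T} =>
  (p.1 \in [set P | partition P D & #|P| == k.+1]) && (p.2 \in p.1))); last first.
  move=> [P B]; rewrite !inE /=; case: (eqVneq B set0) => [->|] /=.
    by case pP: (partition P D); rewrite //= (partition0 pP) andbF.
  by rewrite addn0 -!andbA [(B \in P) && _]andbC.
rewrite -(pair_big_dep (mem [set P | partition P D & #|P| == k.+1])
  (fun P B => B \in P) (fun _ _ => 1)) /= mulnC -sum_nat_const.
by apply: eq_bigr => P; rewrite inE => /andP[_ /eqP<-]; rewrite sum1_card.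
Qed.
End SetPartitions.

(** * Restricted growth words *)

(** Words are read from their last letter to their first, so that [c :: w]
continues [w] by [c].  The labels used are [0], [1], and so on in order of
appearance: a letter equal to the number of labels used so far is a new label. *)
Fixpoint nlab (w : seq nat) : nat :=
  if w is c :: w' then nlab w' + (c == nlab w') else 0.

Fixpoint rgf n : seq (seq nat) :=
  if n is n'.+1 then [seq c :: w | w <- rgf n', c <- iota 0 (nlab w).+1]
  else [:: [::]].

Lemma sum_rgfS n (F : seq nat -> nat) :
  \sum_(w <- rgf n.+1) F w =
  \sum_(w <- rgf n) (\sum_(c < nlab w) F (val c :: w) + F (nlab w :: w)).
Proof.
rewrite /rgf -/rgf big_allpairs_dep; apply: eq_bigr => w _.
by rewrite -(big_mkord predT (fun c => F (c :: w))) -big_nat_recr //= /index_iota subn0.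
Qed.

Lemma nlab_le_size w : nlab w <= size w.
Proof. by elim: w => //= c w IH; case: eqP => _; lia. Qed.

Lemma size_rgf n w : w \in rgf n -> size w = n.
Proof.
elim: n w => [|n IH] w; first by rewrite inE => /eqP->.
by case/allpairsPdep => v [c [vn _ ->]]; rewrite /= (IH v).
Qed.

(** These numbers are the Stirling numbers of the second kind. *)
Definition nrgf n k := \sum_(w <- rgf n) (nlab w == k).

Lemma nrgf0 k : nrgf 0 k = (k == 0).
Proof. by rewrite /nrgf /= big_seq1 eq_sym. Qed.

Lemma nrgfS0 n : nrgf n.+1 0 = 0.
Proof.
rewrite /nrgf sum_rgfS big1 // => w _; rewrite /= eqxx addn1 addn0.
by rewrite big1 // => c _; rewrite addn_eq0 (gtn_eqF (leq_ltn_trans (leq0n c) (ltn_ord c))).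
Qed.

Lemma nrgfSS n k : nrgf n.+1 k.+1 = nrgf n k + k.+1 * nrgf n k.+1.
Proof.
rewrite /nrgf sum_rgfS big_distrr -big_split /=; apply: eq_bigr => w _.
rewrite eqxx addn1 eqSS [LHS]addnC; congr (_ + _).
rewrite (eq_bigr (fun=> (nlab w == k.+1) : nat)) => [|c _].
  by rewrite sum_nat_const card_ord; case: eqP => [->|]; rewrite ?muln0.
by rewrite (ltn_eqF (ltn_ord c)) addn0.
Qed.

Lemma nrgf_gt n k : n < k -> nrgf n k = 0.
Proof.
move=> nk; rewrite /nrgf big_seq big1 // => w /size_rgf sw.
by rewrite ltn_eqF // (leq_ltn_trans (nlab_le_size w)) ?sw.
Qed.

Lemma size_rgfE n : size (rgf n) = \sum_(k < n.+1) nrgf n k.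
Proof.
rewrite /nrgf exchange_big -sum1_size !big_seq /=; apply: eq_bigr => w /size_rgf sw.
have nw : nlab w < n.+1 by rewrite ltnS -sw nlab_le_size.
rewrite (bigD1 (Ordinal nw)) //= eqxx big1 ?addn0 // => i /negPf.
by rewrite eq_sym -val_eqE => ->.
Qed.

(** Both sides satisfy the Stirling recurrence. *)
Lemma num_partitionsE (T : finType) (D : {set T}) k :
  num_partitions D k = nrgf #|D| k.
Proof.
move Dn: #|D| => n; elim: n D Dn k => [|n IH] D Dn k.
  rewrite nrgf0 (cards0_eq Dn) /num_partitions.
  have [->|k0] := eqVneq k 0.
    rewrite (_ : [set _ | _] = [set set0]) ?cards1 //.
    by apply/setP => P; rewrite !inE partition_set0; case: eqP => // ->; rewrite cards0.
  apply/eqP; rewrite cards_eq0; apply/eqP/setP => P; rewrite !inE partition_set0.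
  by case: eqP => // ->; rewrite cards0 eq_sym (negPf k0).
have /set0Pn[x xD] : D != set0 by rewrite -card_gt0 Dn.
case: k => [|k].
  rewrite nrgfS0; apply/eqP; rewrite cards_eq0; apply/eqP/setP => P; rewrite !inE.
  apply/negP => /andP[pP]; rewrite cards_eq0 => /eqP P0.
  by have := cover_partition pP; rewrite P0 /cover big_set0 => E; rewrite -E inE in xD.
have Dx : #|D :\ x| = n by apply/eqP; rewrite -eqSS -Dn (cardsD1 x D) xD.
by rewrite -{1}(setD1K xD) num_partitionsS ?setD11 // !IH // nrgfSS.
Qed.

Lemma stirling2E m k : stirling2 m k = nrgf m k.
Proof.
by rewrite -[RHS](_ : num_partitions [set: 'I_m] k = _) // num_partitionsE cardsT card_ord.
Qed.

Lemma bellE m : bell m = size (rgf m).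
Proof.
rewrite size_rgfE /bell -sum1_card.
rewrite (partition_big (fun P : {set {set 'I_m}} => inord #|P| : 'I_m.+1) predT) //=.
apply: eq_bigr => k _; rewrite sum1dep_card -stirling2E; apply: eq_card => P.
rewrite !inE; apply: andb_id2l => pP; rewrite -val_eqE /= inordK // ltnS.
have := card_partition pP; rewrite cardsT card_ord => Em.
rewrite -sum1_card [leqRHS]Em; apply: leq_sum => A AP.
by rewrite card_gt0 (partition_neq0 pP).
Qed.

(** * Counting admissible words *)

(** The head of a word is the label of the smallest value, and a letter is a
record exactly when it is a new label in front of the rest of the word.
[word_ok] accepts the word if the smallest value is a record.  Otherwise it
stores the label [K] of that value and [low_ok] reads the next values, whose
labels must decrease weakly, [l] being the previous one, up to the first
record.  From there on [high_ok] checks that, below the record with label [K],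
the letters which are not records are at most the last label [L] of the chain. *)
Fixpoint high_ok (K L : nat) (w : seq nat) : bool :=
  if w is d :: w' then
    ((d < nlab w') && (K < nlab w') ==> (d <= L)) && high_ok K L w'
  else true.

Fixpoint low_ok (K l : nat) (w : seq nat) : bool :=
  if w is d :: w' then
    if d == nlab w' then high_ok K l w' else (d <= l) && low_ok K d w'
  else true.

Definition word_ok (w : seq nat) : bool :=
  if w is c :: w' then (c == nlab w') || low_ok c c w' else true.

(** The label [K] is not used in [w], so that no letter of [w] lies below the
record with label [K]. *)
Lemma high_ok_trivial K L w : nlab w <= K -> high_ok K L w.
Proof.
elim: w => //= d w IH wK.
by rewrite IH ?andbT; case: (ltnP K) => wK'; rewrite ?andbF //; lia.
Qed.

(** In a restricted growth word, [K < nlab w] says that the label [K] is used. *)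
Definition count_high K L n := \sum_(w <- rgf n) ((K < nlab w) && high_ok K L w).
Definition count_low K l n := \sum_(w <- rgf n) ((K < nlab w) && low_ok K l w).

Lemma sum_ord_leq N m : m < N -> \sum_(c < N) (c <= m) = m.+1.
Proof.
move=> mN; have -> : m.+1 = \sum_(c < m.+1) 1 by rewrite sum_nat_const card_ord muln1.
rewrite (big_ord_widen _ (fun=> 1) mN).
by rewrite [RHS]big_mkcond; apply: eq_bigr => c _; rewrite ltnS; case: (c <= m).
Qed.

(** If the head is the record with label [K], the rest is any word with [K]
labels.  Otherwise the rest uses [K], and the head is a later record or one of
the labels [0], ..., [L]. *)
Lemma count_highS K L n : L <= K ->
  count_high K L n.+1 = nrgf n K + L.+2 * count_high K L n.
Proof.
move=> LK; rewrite /count_high /nrgf sum_rgfS big_distrr -big_split /=.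
apply: eq_bigr => w _; rewrite eqxx ltnn /= addn1 ltnS.
rewrite (eq_bigr (fun c : 'I__ => ((K < nlab w) && high_ok K L w) * (c <= L))); last first.
  move=> c _; rewrite ltn_ord (ltn_eqF (ltn_ord c)) addn0.
  by case: (K < nlab w) => //=; case: (c <= L); rewrite /= ?muln1 ?muln0.
rewrite -big_distrr /=; case: (ltngtP K (nlab w)) => [KN|KN|EK] /=.
- by rewrite sum_ord_leq ?(leq_ltn_trans LK) //; case: high_ok; lia.
- by rewrite mul0n muln0.
- by rewrite mul0n muln0 high_ok_trivial ?EK.
Qed.

Lemma count_high0 K L : count_high K L 0 = 0.
Proof. by rewrite /count_high big_seq1. Qed.

Lemma count_low0 K L : count_low K L 0 = 0.
Proof. by rewrite /count_low big_seq1. Qed.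

(** The head ends the chain as the record with label [K], or it ends the chain as
a smaller record, or it continues the chain by some [d <= l]. *)
Lemma count_lowS K l n : l <= K ->
  count_low K l n.+1 = nrgf n K + count_high K l n + \sum_(d < l.+1) count_low K d n.
Proof.
move=> lK; rewrite /count_low /count_high /nrgf sum_rgfS exchange_big -!big_split /=.
apply: eq_bigr => w _; rewrite eqxx addn1 ltnS addnC; congr (_ + _).
  case: (ltngtP K (nlab w)) => [KN|KN|EK] //=.
  by rewrite high_ok_trivial ?EK.
rewrite (eq_bigr (fun c : 'I__ =>
  if c <= l then (K < nlab w) && low_ok K c w : nat else 0)); last first.
  move=> c _; rewrite (ltn_eqF (ltn_ord c)) addn0.
  by case: (c <= l); rewrite //= andbF.
case: (ltnP K (nlab w)) => [KN|KN] /=; last first.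
  by rewrite big1 ?big1 // => c _; case: ifP.
have lN : l < nlab w by apply: leq_ltn_trans lK KN.
by rewrite -big_mkcond /= (big_ord_widen _ (fun d => low_ok K d w : nat) lN).
Qed.

(** The head is a new label, or it is the label [K] of a smallest value that is
not a record and starts the chain. *)
Lemma sum_word_ok n :
  \sum_(w <- rgf n.+1) word_ok w = size (rgf n) + \sum_(K < n) count_low K K n.
Proof.
rewrite /count_low exchange_big -sum1_size sum_rgfS -big_split /= !big_seq.
apply: eq_bigr => w /size_rgf sw; rewrite eqxx addnC; congr (_ + _).
have Nn : nlab w <= n by rewrite -sw nlab_le_size.
rewrite (big_ord_widen _ (fun c => (c == nlab w) || low_ok c c w : nat) Nn).
rewrite [LHS]big_mkcond.
by apply: eq_bigr => c _; case: ltngtP.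
Qed.

(** * From permutations to words *)

Definition is_record n (s : 'S_n) (p : 'I_n) : bool :=
  [forall q : 'I_n, (q < p) ==> (s q < s p)].

(** Labels number the blocks between records from right to left. *)
Definition label n (s : 'S_n) (v : 'I_n) : nat :=
  #|[pred p | is_record s p & (s^-1)%g v < p]|.

Definition word n (s : 'S_n) : seq nat := [seq label s v | v <- enum 'I_n].

(** After an entry that is not a record, the entries increase up to the next
record. *)
Definition separated n (s : 'S_n) : bool :=
  [forall q : 'I_n, forall r : 'I_n, [&& q < r, ~~ is_record s q & s r < s q] ==>
    [exists t : 'I_n, [&& q < t, t < r & is_record s t]]].

Lemma recordP n (s : 'S_n) (p : 'I_n) :
  reflect (forall q : 'I_n, q < p -> s q < s p) (is_record s p).
Proof. by apply: (iffP forallP) => H q; [apply/implyP | apply/implyP/H]. Qed.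

Lemma recordPn n (s : 'S_n) (p : 'I_n) :
  reflect (exists2 q : 'I_n, q < p & s p < s q) (~~ is_record s p).
Proof.
rewrite negb_forall; apply: (iffP existsP) => -[q].
  rewrite negb_imply -leqNgt => /andP[qp].
  rewrite leq_eqVlt val_eqE => /orP[/eqP/perm_inj E|]; last by exists q.
  by rewrite E ltnn in qp.
by move=> qp sq; exists q; rewrite negb_imply qp -leqNgt ltnW.
Qed.

Lemma separatedP n (s : 'S_n) : reflect
  (forall q r : 'I_n, q < r -> ~~ is_record s q -> s r < s q ->
     exists t : 'I_n, [/\ q < t, t < r & is_record s t]) (separated s).
Proof.
apply: (iffP forallP) => H q.
  move=> r qr nq srq; move/forallP/(_ r): (H q); rewrite qr nq srq.
  by case/existsP => t /and3P[]; exists t.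
apply/forallP => r; apply/implyP => /and3P[qr nq srq].
by have [t [? ? ?]] := H q r qr nq srq; apply/existsP; exists t; apply/and3P.
Qed.

Lemma card_lift n (i : 'I_n.+1) (P : pred 'I_n.+1) :
  #|P| = P i + #|[pred p | P (lift i p)]|.
Proof.
rewrite -!sum1_card big_mkcond (bigD1_ord i) //= -big_mkcond.
by congr (_ + _); rewrite unfold_in; case: (P i).
Qed.

Lemma ltn_lift n (i : 'I_n.+1) (p q : 'I_n) : (lift i p < lift i q) = (p < q).
Proof. by rewrite !ltnNge leq_bump2. Qed.

Lemma lt_self_lift n (i : 'I_n.+1) (q : 'I_n) : (i < lift i q) = (i <= q).
Proof. by rewrite /= /bump; case: leqP => /=; lia. Qed.

(** The number of elements of [P] above [j] takes each value below [#|P|] once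
when [j] runs over [P]. *)
Lemma sum_over_rank n (P : pred 'I_n) (G : nat -> nat) :
  \sum_(j | P j) G #|[pred q | P q & j < q]| = \sum_(c < #|P|) G c.
Proof.
elim: n P => [|n IH] P.
  rewrite big_ord0 (_ : #|P| = 0) ?big_ord0 //.
  by apply: eq_card0 => -[].
rewrite big_mkcond big_ord_recl -big_mkcond /= (card_lift ord0).
set P' := [pred p | P (lift ord0 p)].
have -> : #|[pred q | P q & 0 < q]| = #|P'|.
  by rewrite (card_lift ord0) /= andbF; apply: eq_card => q; rewrite !inE /= andbT.
have -> : \sum_(i < n | P (lift ord0 i)) G #|[pred q | P q & lift ord0 i < q]|
          = \sum_(c < #|P'|) G c.
  rewrite -IH; apply: eq_bigr => j _; congr G.
  by rewrite [LHS](card_lift ord0) /= andbF; apply: eq_card.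
by case: (P ord0); rewrite ?add0n // add1n big_ord_recr /= addnC.
Qed.

(** The permutation [s'] arises from [s] by raising all values by one and
inserting the value [0] at position [i]. *)
Section Lift.
Variables (n : nat) (i : 'I_n.+1) (s : 'S_n).
Let s' := lift_perm i ord0 s.

Lemma record_lift p : is_record s' (lift i p) = is_record s p.
Proof.
apply/recordP/recordP => H q qp.
  have := H (lift i q); rewrite !ltn_lift !lift_perm_lift !ltn_lift; exact.
case: (unliftP i q) qp => [q'|] ->; last by rewrite lift_perm_id lift_perm_lift.
by rewrite ltn_lift !lift_perm_lift ltn_lift; apply: H.
Qed.

Lemma record_lift_id : is_record s' i = (i == ord0).
Proof.
apply/recordP/eqP => [H|-> //]; apply/val_inj/eqP; rewrite /= -leqn0 leqNgt.
by apply/negP => /(H ord0); rewrite lift_perm_id.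
Qed.

Definition insertion_label := #|[pred q : 'I_n | is_record s q & i <= q]|.

Lemma word_lift : word s' = insertion_label :: word s.
Proof.
rewrite /word enum_ordSl /= -map_comp; congr (_ :: _).
  rewrite /label /s' lift_permV lift_perm_id (card_lift i) /= ltnn andbF.
  by apply: eq_card => q; rewrite !inE record_lift lt_self_lift.
apply: eq_map => v /=; rewrite /label (card_lift i) /= record_lift_id.
have -> : (s'^-1)%g (lift ord0 v) = lift i ((s^-1)%g v).
  by rewrite /s' lift_permV lift_perm_lift.
rewrite (_ : (_ == _) && _ = false); last by apply/andP => -[/eqP->]; rewrite ltn0.
by apply: eq_card => q; rewrite !inE record_lift; congr (_ && _); apply: ltn_lift.
Qed.

(** If the position before [i] holds an entry that is not a record, then this
entry exceeds the inserted one with no record in between. *)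
Lemma separated_lift : separated s' =
  separated s && ((i == ord0) || [exists j : 'I_n, (j.+1 == i) && is_record s j]).
Proof.
apply/separatedP/andP => [H|[/separatedP H adm]].
  split.
    apply/separatedP => q r qr nq rq.
    have [||| t] := H (lift i q) (lift i r); rewrite ?ltn_lift ?record_lift ?lift_perm_lift ?ltn_lift //.
    case: (unliftP i t) => [t'|] -> []; first by rewrite !ltn_lift record_lift; exists t'.
    rewrite record_lift_id => + + /eqP i0; by rewrite i0 ltn0.
  have [//|i0] := eqVneq i ord0; rewrite /=.
  have i1n : i.-1 < n by case: i i0 => -[] //= m mn.
  pose j := Ordinal i1n; have ji : j.+1 = i by rewrite /= prednK // lt0n.
  have lj : lift i j = j :> nat by rewrite /= /bump -ji ltnn.
  apply/existsP; exists j; rewrite ji eqxx /=; apply/negPn/negP => nj.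
  have [|||t [jt ti]] := H (lift i j) i; rewrite ?lj ?record_lift ?lift_perm_id ?lift_perm_lift -?ji //.
  by move: jt ti; rewrite lj -ji; lia.
move=> q r; case: (unliftP i q) => [q'|] ->; last first.
  by rewrite lift_perm_id ltn0.
case: (unliftP i r) => [r'|] ->.
  rewrite !lift_perm_lift !ltn_lift record_lift => qr nq rq.
  have [t [qt tr tc]] := H _ _ qr nq rq.
  by exists (lift i t); rewrite !ltn_lift record_lift.
rewrite record_lift => qi nq _; case/orP: adm => [/eqP i0|/existsP[j /andP[/eqP ji rj]]].
  by rewrite i0 ltn0 in qi.
exists (lift i j); rewrite record_lift ltn_lift; split=> //; last first.
  by rewrite /= /bump -ji ltnn.
have qi' : q' < i by move: qi; rewrite /= /bump; lia.
rewrite ltn_neqAle -[_ <= j]ltnS ji qi' andbT.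
by apply: contra nq => /eqP/val_inj ->.
Qed.
End Lift.

Lemma lift_perm0_bij n :
  bijective (fun x : 'I_n.+1 * 'S_n => lift_perm x.1 ord0 x.2).
Proof.
apply: inj_card_bij; last by rewrite card_prod card_ord !card_Sn factS.
move=> [i s] [j t] /= E.
have ij : i = j.
  by apply: (@perm_inj _ (lift_perm i ord0 s)); rewrite {2}E !lift_perm_id.
move: E; rewrite -ij => E; congr (_, _); apply/permP => k.
by have /permP/(_ (lift i k)) := E; rewrite !lift_perm_lift => /lift_inj.
Qed.

Lemma lift_perm0_ex n (s : 'S_n.+1) : exists i t, s = lift_perm i ord0 t.
Proof. by case: (lift_perm0_bij n) => g _ K; exists (g s).1, (g s).2; rewrite K. Qed.

Lemma perm0E (s : 'S_0) : s = 1%g.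
Proof. by apply/permP => -[]. Qed.

Lemma word0 (s : 'S_0) : word s = [::].
Proof. by apply: size0nil; rewrite size_map size_enum_ord. Qed.

(** This is what lets a word recognise records: the value [v] is one exactly
when its label is the number of records above [v]. *)
Lemma nlab_drop_word n (s : 'S_n) v :
  nlab (drop v (word s)) = #|[pred p | is_record s p & v <= s p]|.
Proof.
elim: n s v => [|n IH] s v.
  by rewrite word0 /= eq_card0 // => -[].
have [i [t ->]] := lift_perm0_ex s; rewrite word_lift; case: v => [|v] /=.
  have := IH t 0; rewrite drop0 => ->.
  rewrite [RHS](card_lift i) /= record_lift_id andbT addnC; congr (_ + _); last first.
    by apply: eq_card => p; rewrite !inE record_lift.
  rewrite /insertion_label; congr nat_of_bool; apply/eqP/eqP => [E|->]; last by apply: eq_card.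
  apply/val_inj/eqP; rewrite /= -leqn0 leqNgt; apply/negP => i0.
  have n0 : 0 < n by rewrite (leq_trans i0) // -ltnS.
  pose p0 := Ordinal n0; have rp0 : is_record t p0 by apply/recordP.
  move: E; rewrite [RHS](cardD1 p0) !inE rp0 /=; apply/eqP.
  rewrite ltn_eqF // add1n ltnS; apply: subset_leq_card; apply/subsetP => q.
  rewrite !inE => /andP[-> iq]; rewrite !andbT.
  by apply: contraTneq iq => ->; rewrite -ltnNge.
rewrite IH [RHS](card_lift i) /= lift_perm_id andbF; apply: eq_card => p.
by rewrite !inE record_lift lift_perm_lift.
Qed.

Lemma nlab_word n (s : 'S_n) : nlab (word s) = #|[pred p | is_record s p]|.
Proof.
by rewrite -[word s]drop0 nlab_drop_word; apply: eq_card => p; rewrite !inE andbT.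
Qed.

(** A new smallest value may be inserted in front or after any of the [k]
records, and its label takes each of the values [0], ..., [k] once. *)
Lemma sum_separated n (F : seq nat -> nat) :
  \sum_(s : 'S_n | separated s) F (word s) = \sum_(w <- rgf n) F w.
Proof.
elim: n F => [|n IH] F.
  rewrite big_seq1 (big_pred1 (1%g : 'S_0)) ?word0 // => s.
  by rewrite /= [s]perm0E eqxx; apply/separatedP => -[].
rewrite sum_rgfS -IH (reindex _ (onW_bij _ (lift_perm0_bij n))) /=.
rewrite (eq_bigl (fun x => predT x.1 && (separated x.2 &&
    ((x.1 == ord0) || [exists j : 'I_n, (j.+1 == x.1) && is_record x.2 j]))));
  last by move=> x; rewrite separated_lift.
rewrite -(pair_big_dep predT (fun i (s : 'S_n) => separated s &&
    ((i == ord0) || [exists j : 'I_n, (j.+1 == i) && is_record s j]))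
  (fun i s => F (word (lift_perm i ord0 s)))) /=.
rewrite (exchange_big_dep (@separated n)) /=; last by move=> i s _ /andP[].
apply: eq_bigr => s Bs; rewrite Bs /= big_mkcond big_ord_recl /=.
rewrite nlab_word -(sum_over_rank _ (fun c => F (c :: word s))) addnC; congr (_ + _).
  rewrite [RHS]big_mkcond; apply: eq_bigr => j _; rewrite word_lift.
  have -> : [exists j0 : 'I_n, (j0.+1 == lift ord0 j) && is_record s j0] = is_record s j.
    apply/existsP/idP => [[k /andP[/eqP[/val_inj ->]]]//|rj].
    by exists j; rewrite eqxx.
  by [].
by rewrite word_lift; congr (F (_ :: _)); apply: eq_card => q; rewrite !inE andbT.
Qed.

(** * Avoidance read off the word *)

Lemma high_okP K L w : reflect
  (forall v, v < size w -> nth 0 w v < nlab (drop v.+1 w) ->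
     K < nlab (drop v.+1 w) -> nth 0 w v <= L) (high_ok K L w).
Proof.
elim: w => [|d w IH] /=; first by constructor.
apply: (iffP andP) => [[H /IH H'] [|v]|H] /=.
- by rewrite drop0 => _ dw Kw; move: H; rewrite dw Kw.
- by rewrite ltnS; apply: H'.
split; last by apply/IH => v vw; apply: (H v.+1).
by apply/implyP => /andP[dw Kw]; apply: (H 0) => //=; rewrite drop0.
Qed.

(** Here [m] is the index of the first record. *)
Lemma low_okP K l w m : m < size w -> nth 0 w m = nlab (drop m.+1 w) ->
  (forall v, v < m -> nth 0 w v <> nlab (drop v.+1 w)) ->
  low_ok K l w <-> (forall u v, u < v -> v <= m -> nth 0 (l :: w) v <= nth 0 (l :: w) u) /\
               high_ok K (nth 0 (l :: w) m) (drop m.+1 w).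
Proof.
elim: w l m => // d w IH l [_|m] /=.
  rewrite drop0 => -> _; rewrite eqxx; split=> [H|[]//]; split=> // u v uv.
  by rewrite leqn0 => /eqP v0; rewrite v0 in uv.
rewrite ltnS => mw Em Ev; have := Ev 0 isT; rewrite /= drop0 => /eqP/negPf->.
have {}IH := IH d m mw Em (fun v => Ev v.+1); split.
  case/andP=> dl /IH[H H2]; split=> // u [//|v]; rewrite ltnS => uv vm /=.
  case: u uv => [_|u uv] /=; last exact: H.
  by case: v vm => [//|v] vm; apply: leq_trans dl; apply: (H 0 v.+1).
case=> H H2; rewrite (H 0 1) //=; apply/IH; split=> // u v uv vm.
by apply: (H u.+1 v.+1).
Qed.

Definition records_above n (s : 'S_n) (v : nat) := #|[pred p | is_record s p & v < s p]|.

Section Labels.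
Variables (n : nat) (s : 'S_n).
Implicit Types u v a b p q t : 'I_n.
Local Notation pos := (s^-1)%g.

Lemma nth_word v : nth 0 (word s) v = label s v.
Proof. by rewrite (nth_map v) ?size_enum_ord // nth_ord_enum. Qed.

Lemma size_word : size (word s) = n.
Proof. by rewrite size_map size_enum_ord. Qed.

Lemma label_anti u v : pos u <= pos v -> label s v <= label s u.
Proof.
move=> uv; apply: subset_leq_card; apply/subsetP => p; rewrite !inE => /andP[-> /=].
exact: leq_ltn_trans.
Qed.

Lemma label_strict t u v : is_record s t -> pos u < t -> t <= pos v -> label s v < label s u.
Proof.
move=> rt ut tv; apply: proper_card; apply/properP; split.
  apply/subsetP => p; rewrite !inE => /andP[-> /=].
  by apply: leq_ltn_trans; apply: leq_trans tv; apply: ltnW.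
by exists t; rewrite !inE rt //= -leqNgt.
Qed.

Lemma label_lt_pos u v : label s v < label s u -> pos u < pos v.
Proof. by rewrite !ltnNge; apply: contra; apply: label_anti. Qed.

(** The first entry above [b] is a record. *)
Lemma first_above b p : b < s p ->
  exists t, [/\ t <= p, b < s t, is_record s t & forall q, q < t -> s q <= b].
Proof.
move=> bp; have [t bt mint] := arg_minnP (fun q : 'I_n => q : nat) (P := fun q => b < s q) bp.
have H q : q < t -> s q <= b by move=> qt; rewrite leqNgt; apply/negP => /mint; rewrite leqNgt qt.
exists t; split=> //; first exact: mint.
by apply/recordP => q /H qb; apply: leq_ltn_trans bt.
Qed.

(** The first entry above [b] is a record which the label of [u] does not count,
whereas every record to the right of [u] is larger than that entry. *)
Lemma label_lt_records u b p : p <= pos u -> b < s p -> label s u < records_above s b.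
Proof.
move=> pu /first_above[t [tp bt rt _]]; apply: proper_card; apply/properP; split.
  apply/subsetP => q; rewrite !inE => /andP[rq uq]; rewrite rq /=.
  by apply: ltn_trans bt _; apply: (recordP _ _ rq); apply: leq_ltn_trans uq; apply: leq_trans pu.
by exists t; rewrite !inE rt //= -leqNgt (leq_trans tp).
Qed.

(** Otherwise every record above [b] lies to the right of [u]. *)
Lemma label_lt_records_ex u b : label s u < records_above s b ->
  exists2 p : 'I_n, p <= pos u & b < s p.
Proof.
move=> lt; have [p /andP[pu bp]|N] := pickP [pred p : 'I_n | (p <= pos u) && (b < s p)].
  by exists p.
move: lt; rewrite ltnNge => /negP[]; apply: subset_leq_card; apply/subsetP => p.
by rewrite !inE => /andP[-> bp]; have := N p; rewrite /= bp andbT leqNgt => /negbFE.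
Qed.

Lemma label_le_records b : label s b <= records_above s b.
Proof.
apply: subset_leq_card; apply/subsetP => p; rewrite !inE => /andP[rp bp].
by rewrite rp; have := recordP _ _ rp _ bp; rewrite permKV.
Qed.

Lemma nonrecord_label b : ~~ is_record s (pos b) = (label s b < records_above s b).
Proof.
apply/recordPn/idP => [[q qb]|/label_lt_records_ex[q qb sq]].
  by rewrite permKV => sq; apply: label_lt_records sq; apply: ltnW.
exists q; rewrite ?permKV // ltn_neqAle qb andbT.
by apply: contraTneq sq => /val_inj->; rewrite permKV ltnn.
Qed.

Lemma separated_label_lt a b :
  separated s -> ~~ is_record s (pos b) -> pos b < pos a -> a < b ->
  label s a < label s b.
Proof.
move=> /separatedP B nb ba ab; have [|t [bt ta rt]] := B _ _ ba nb; first by rewrite !permKV.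
exact: label_strict rt bt (ltnW ta).
Qed.
End Labels.

(** The first entry is the smallest record, so the chain consists of the values
below it.  By [label_lt_records] and [label_lt_records_ex], the two conditions
on [records_above] say that an entry larger than [b] precedes [b], respectively
the value [0]. *)
Lemma word_ok_perm n (s : 'S_n.+1) : word_ok (word s) <->
  s ord0 = ord0 \/
  (forall u v : 'I_n.+1, u < v -> v < s ord0 -> label s v <= label s u) /\
  (forall a b : 'I_n.+1, a.+1 = s ord0 -> s ord0 < b -> label s b < records_above s b ->
      label s ord0 < records_above s b -> label s b <= label s a).
Proof.
set w := word s; set m := s ord0.
have sw : size w = n.+1 by apply: size_word.
have nl v : nlab (drop v.+1 w) = records_above s v by rewrite nlab_drop_word.
have wn (v : 'I_n.+1) : nth 0 w v = label s v by rewrite nth_word.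
have rm : is_record s ord0 by apply/recordP.
have Em : nth 0 w m = nlab (drop m.+1 w).
  apply/eqP; rewrite wn nl eqn_leq label_le_records leqNgt -nonrecord_label permK.
  by rewrite rm.
have Ev v : v < m -> nth 0 w v <> nlab (drop v.+1 w).
  move=> vm; have vn : v < n.+1 by apply: ltn_trans vm _.
  have := wn (Ordinal vn); rewrite nl /= => ->; apply/eqP; rewrite neq_ltn.
  apply/orP; left; apply: (@label_lt_records _ s _ (Ordinal vn) ord0) => //.
have [m0|m0] := eqVneq m ord0.
  split=> [_|_]; first by left.
  move: Em; rewrite m0 /= drop1; case: (w) => //= c w' ->.
  by rewrite eqxx.
have mpos : 0 < m by rewrite lt0n.
case Ew : w sw => [//|c w'] /= [sw'].
have c0 : (c == nlab w') = false.
  by apply/eqP => c0; apply: (Ev 0 mpos); rewrite Ew /= drop0.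
rewrite c0 /=; have m1 : m.-1.+1 = m by rewrite prednK.
have := @low_okP c c w' m.-1; rewrite m1 -Ew => -> //; first last.
- move=> v vm; have := Ev v.+1; rewrite Ew /=; apply; lia.
- by move: Em; rewrite -m1 Ew.
- by rewrite sw' -ltnS.
have lc : c = label s ord0 by rewrite -wn Ew.
have dm : drop m w' = drop m.+1 w by rewrite Ew.
have nd v k : v = m.+1 + k -> (nth 0 (drop m.+1 w) k = nth 0 w v) *
    (drop k.+1 (drop m.+1 w) = drop v.+1 w).
  by move->; rewrite nth_drop drop_drop addnC addSn -addnS.
rewrite dm; split=> [[H /high_okP H2]|].
  right; split=> [u v uv vm|a b am mb bn b0].
    by rewrite -!wn; apply: H => //; lia.
  have bE : b = m.+1 + (b - m.+1) :> nat by lia.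
  have := H2 (b - m.+1); rewrite !(nd _ _ bE) nl wn -am /= wn lc; apply=> //.
  by rewrite size_drop am; move: (ltn_ord b); rewrite Ew /= sw'; lia.
case=> [/eqP|[H1 H2]]; first by rewrite (negPf m0).
have on v : v < m -> v < n.+1 by move/ltn_trans; apply.
split=> [u v uv vm|].
  have [um vm'] : u < m /\ v < m by lia.
  by have := H1 (Ordinal (on u um)) (Ordinal (on v vm')) uv vm'; rewrite -!wn.
apply/high_okP => k; rewrite size_drop => kn.
have bn : m.+1 + k < n.+1 by move: kn; rewrite Ew /= sw'; lia.
rewrite !(nd _ k erefl) nl => wk ck.
have am : m.-1 < m by rewrite m1.
have := H2 (Ordinal (on _ am)) (Ordinal bn) m1; rewrite -lc -!wn /=; apply=> //.
by rewrite leq_addr.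
Qed.

(* the two halves of the avoidance condition *)
Lemma avoidsP n (s : 'S_n) : reflect
  (forall p q r : 'I_n, p < q -> q < r -> s q < s p -> s r < s q ->
     (exists2 t : 'I_n, t < p & s t < s r) /\ (exists t : 'I_n, [/\ q < t, t < r & s p < s t]))
  (avoids_bar1_43_bar5_2 s).
Proof.
apply: (iffP forallP) => H p.
  move=> q r pq qr sqp srq.
  have /forallP/(_ r) := forallP (H p) q; rewrite pq qr sqp srq /=.
  case/andP=> /existsP[t /andP[? ?]] /existsP[u /and3P[? ? ?]].
  by split; [exists t | exists u].
apply/forallP => q; apply/forallP => r; apply/implyP => /and4P[pq qr sqp srq].
have [[t tp st] [u [qu ur su]]] := H p q r pq qr sqp srq.
apply/andP; split; apply/existsP; first by exists t; rewrite tp.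
by exists u; rewrite qu ur.
Qed.

(** A record in between exceeds all earlier entries, in particular the first of
the three. *)
Lemma separated_between n (s : 'S_n) : separated s <->
  (forall p q r : 'I_n, p < q -> q < r -> s q < s p -> s r < s q ->
     exists t : 'I_n, [/\ q < t, t < r & s p < s t]).
Proof.
split=> [/separatedP B p q r pq qr sqp srq|H].
  have [|t [qt tr rt]] := B q r qr _ srq; first by apply/recordPn; exists p.
  by exists t; split=> //; apply: (recordP _ _ rt); apply: ltn_trans qt.
apply/separatedP => q r qr /recordPn[p pq sqp] srq.
(* The maximum of the prefix exceeds all its other entries and [s q], so that
   the first entry above it lies to the right of q and is a record. *)
case: (arg_maxnP (P := fun p : 'I_n => p < q) (fun p => s p : nat) pq) => p' pq' maxp.
have [|t [qt tr st]] := H p' q r pq' qr _ srq; first exact: leq_trans sqp (maxp _ pq).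
have [t' [tt' st' rt' Ht']] := first_above st.
exists t'; split=> //; last exact: leq_ltn_trans tt' tr.
rewrite ltnNge; apply/negP; rewrite leq_eqVlt => /orP[/eqP/val_inj E|t'q].
  have := maxp _ pq; move: st'; rewrite E; lia.
by have := leq_ltn_trans (maxp _ t'q) st'; rewrite ltnn.
Qed.

(** Let m be the first entry.  If two values below m were decreasing, m would
start a pattern with nothing to its left.  If b > m is not a record, has a
larger entry before the value 0 and lies left of m - 1, the first entry above b,
then b, then m - 1 form a pattern, and the required smaller entry would be a
value below m placed before 0.  Conversely, when the 4 of a pattern is to the
right of 0, the value 0 serves as 1; when it is to the left of 0 and the 2
exceeds m, then m does; and the conditions on the word exclude the remaining
patterns, since the 3 of a pattern has a larger label than its 2. *)
Lemma avoids_word_ok n (s : 'S_n) :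
  avoids_bar1_43_bar5_2 s = separated s && word_ok (word s).
Proof.
case: n s => [|n] s.
  rewrite word0 andbT; apply/idP/idP => _; first by apply/separatedP => -[].
  by apply/avoidsP => -[].
have r0 : is_record s ord0 by apply/recordP.
apply/avoidsP/andP => [H|[B /word_ok_perm HQ] p q r pq qr sqp srq].
  have B : separated s by apply/separated_between => p q r pq qr sqp srq; case: (H p q r).
  split=> //; apply/word_ok_perm.
  have [->|m0] := eqVneq (s ord0) ord0; [by left | right].
  have low (u v : 'I_n.+1) : u < v -> v < s ord0 -> (s^-1)%g u < (s^-1)%g v.
    move=> uv vm; rewrite ltnNge; apply/negP; rewrite leq_eqVlt => /orP[/eqP/val_inj|vu].
      by move/perm_inj => E; rewrite E ltnn in uv.
    have [|||[]//] := H ord0 _ _ _ vu; rewrite ?permKV //.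
    rewrite lt0n; apply: contraTneq vm => v0; rewrite -(permKV s v) (_ : (s^-1)%g v = ord0) ?ltnn //.
    exact: val_inj.
  split=> [u v uv vm|a b am mb bn b0]; first exact/label_anti/ltnW/low.
  rewrite leqNgt; apply/negP => /label_lt_pos ba.
  have [p pb sp] := label_lt_records_ex bn; have [p' p0' sp'] := label_lt_records_ex b0.
  (* The pattern consists of the first entry above b, b itself and a. *)
  have [t [tp st rt Ht]] := first_above sp.
  have tb : t < (s^-1)%g b.
    rewrite ltn_neqAle (leq_trans tp pb) andbT; apply: contraTneq st => /val_inj->.
    by rewrite permKV ltnn.
  have t0 : t <= (s^-1)%g ord0.
    by rewrite leqNgt; apply/negP => t0; have := Ht p' (leq_ltn_trans p0' t0); rewrite leqNgt sp'.
  have [||[x xt sx] _] := H t _ _ tb ba; rewrite ?permKV //; first by lia.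
  move: sx; rewrite permKV => sx.
  have x0 : (ord0 : 'I_n.+1) < s x.
    rewrite lt0n; apply/eqP => x0; have E : x = (s^-1)%g ord0.
      by apply: (@perm_inj _ s); rewrite permKV; apply: val_inj.
    by have := leq_trans xt t0; rewrite E ltnn.
  have sxm : s x < s ord0 by rewrite -am ltnS ltnW.
  by have := low _ _ x0 sxm; rewrite permK ltnNge (ltnW (leq_trans xt t0)).
have [t [qt tr st]] := (proj1 (separated_between s) B) p q r pq qr sqp srq.
split; last by exists t.
have nq : ~~ is_record s q by apply/recordPn; exists p.
have rq : label s (s r) < label s (s q) by apply: separated_label_lt => //; rewrite ?permK //.
case: HQ => [m0|[low high]].
  exists ord0; rewrite ?m0 /= lt0n.
    by apply: contraTneq sqp => p0; rewrite (_ : p = ord0) ?m0 //; apply: val_inj.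
  apply: contraTneq qr => r0'; rewrite -leqNgt.
  by rewrite (_ : r = ord0) //; apply: (@perm_inj _ s); rewrite m0; apply: val_inj.
have [z0|z0] := ltnP ((s^-1)%g ord0) p.
  exists ((s^-1)%g ord0) => //; rewrite permKV lt0n.
  apply: contraTneq (ltn_trans pq qr) => sr0; rewrite -leqNgt.
  rewrite (_ : r = (s^-1)%g ord0); first exact: ltnW.
  by apply: (@perm_inj _ s); rewrite permKV; apply: val_inj.
have neq0 (x : 'I_n.+1) : 0 < x -> s x != s ord0 :> nat.
  by rewrite lt0n; apply: contraNneq => /val_inj/perm_inj->.
have [rm|mr] := ltnP (s ord0) (s r).
  exists ord0 => //; rewrite lt0n; apply: contraTneq (ltn_trans rm (ltn_trans srq sqp)) => p0.
  by rewrite (_ : p = ord0) ?ltnn //; apply: val_inj.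
have {}mr : s r < s ord0 by rewrite ltn_neqAle mr neq0 //; apply: leq_ltn_trans qr.
(* The 4 is to the left of 0 and the 2 is below m: there is no such pattern. *)
suff : label s (s q) <= label s (s r) by rewrite leqNgt rq.
have [qm|qm] := ltnP (s q) (s ord0); first exact: low.
have {}qm : s ord0 < s q by rewrite ltn_neqAle qm eq_sym neq0 //; apply: leq_ltn_trans pq.
have mn : (s ord0).-1 < n.+1 by apply: leq_ltn_trans (leq_pred _) _.
pose a := Ordinal mn; have am : a.+1 = s ord0 by rewrite /= prednK //; apply: leq_ltn_trans mr.
have qa : label s (s q) <= label s a.
  apply: high => //; last exact: label_lt_records z0 sqp.
  by rewrite -nonrecord_label permK.
apply: leq_trans qa _; have [ra|ra] := ltnP (s r) a; first by apply: low => //; rewrite -am.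
by rewrite (_ : s r = a) //; apply: val_inj; apply/eqP; rewrite eqn_leq ra andbT -ltnS am.
Qed.

(** * Summation *)

(** The number of weak compositions of [e] into [a] parts. *)
Definition weak_comp a e := if a is a'.+1 then 'C(e + a', e) else nat_of_bool (e == 0).
Arguments weak_comp : simpl never.

Lemma weak_compn0 a : weak_comp a 0 = 1.
Proof. by case: a => // a; rewrite /weak_comp bin0. Qed.

Lemma weak_compSS a x : weak_comp a.+1 x.+1 = weak_comp a.+1 x + weak_comp a x.+1.
Proof.
rewrite /weak_comp; case: a => [|a] /=; first by rewrite !addn0 !binn.
by rewrite addSnnS addnS binS addSnnS addnC.
Qed.

(** The difference [l - d] is one more part. *)
Lemma sum_weak_comp_conv a (f : nat -> nat) l :
  \sum_(d < l.+1) \sum_(e < d.+1) weak_comp a (d - e) * f e =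
  \sum_(e < l.+1) weak_comp a.+1 (l - e) * f e.
Proof.
elim: l => [|l IH]; first by rewrite !big_ord1 !weak_compn0.
rewrite big_ord_recr IH /= [X in _ + X = _]big_ord_recr [RHS]big_ord_recr /=.
rewrite subnn !weak_compn0 addnA.
rewrite -big_split; congr (_ + _); apply: eq_bigr => e _ /=.
by rewrite subSn ?weak_compSS ?mulnDl // -ltnS.
Qed.

Lemma sum_weak_comp a l : \sum_(e < l.+1) weak_comp a (l - e) = weak_comp a.+1 l.
Proof.
elim: l => [|l IH]; first by rewrite big_ord1 !weak_compn0.
rewrite big_ord_recl weak_compSS -IH subn0 addnC; congr (_ + _).
Qed.

(** Here [b] is the number of letters below the record with label [K]. *)
Lemma count_highE K L n : L <= K ->
  count_high K L n = \sum_(b < n) L.+2 ^ b * nrgf (n - b.+1) K.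
Proof.
move=> LK; elim: n => [|n IH]; first by rewrite count_high0 big_ord0.
rewrite count_highS // IH big_ord_recl mul1n subn1 big_distrr; congr (_ + _).
by apply: eq_bigr => b _; rewrite /= mulnA -expnS.
Qed.

(** Here [a] is the number of letters of the chain after the starting label [l],
and [e] is the last label of the chain. *)
Lemma count_lowE K l n : l <= K -> count_low K l n =
  \sum_(a < n) \sum_(e < l.+1)
    weak_comp a (l - e) * (nrgf (n - a.+1) K + count_high K e (n - a.+1)).
Proof.
elim: n l => [|n IH] l lK; first by rewrite count_low0 big_ord0.
rewrite count_lowS // [RHS]big_ord_recl /= subn1; congr (_ + _).
  rewrite big_ord_recr /= subnn weak_compn0 mul1n big1 // => e _.
  by rewrite /weak_comp subn_eq0 leqNgt ltn_ord.
transitivity (\sum_(d < l.+1) \sum_(a < n) \sum_(e < d.+1)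
    weak_comp a (d - e) * (nrgf (n - a.+1) K + count_high K e (n - a.+1))).
  by apply: eq_bigr => d _; rewrite IH // (leq_trans _ lK) // -ltnS.
rewrite exchange_big; apply: eq_bigr => a _ /=.
by rewrite (sum_weak_comp_conv a (fun e => nrgf (n - a.+1) K + count_high K e (n - a.+1))).
Qed.

(** Set partitions of [c] elements into [k] blocks together with a chain of
labels in [0], ..., [k]: in [block_sum] the chain starts at [k] and has [x]
further letters, and in [chain_sum] its last letter [i] moreover leaves [i + 2]
choices for each of [b] elements. *)
Definition block_sum x c := \sum_(k < c.+1) 'C(x + k, k) * nrgf c k.
Definition chain_sum x b c :=
  \sum_(k < c.+1) (\sum_(i < k.+1) weak_comp x (k - i) * i.+2 ^ b) * nrgf c k.

Lemma block_sum0 x : block_sum x 0 = 1.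
Proof. by rewrite /block_sum big_ord1 bin0 nrgf0. Qed.

Lemma chain_sum0 x b : chain_sum x b 0 = 2 ^ b.
Proof. by rewrite /chain_sum !big_ord1 weak_compn0 nrgf0 mul1n muln1. Qed.

Lemma sum_nrgf_trunc (F : nat -> nat) c n : c < n ->
  \sum_(k < n) F k * nrgf c k = \sum_(k < c.+1) F k * nrgf c k.
Proof.
move=> cn; rewrite (big_ord_widen _ (fun k => F k * nrgf c k) cn) [RHS]big_mkcond /=.
by apply: eq_bigr => k _; case: ltnP => // ck; rewrite nrgf_gt ?muln0.
Qed.

(** The first sum is the case where the first entry of the permutation is the
record with label [K]. *)
Lemma sum_count_low n : \sum_(K < n) count_low K K n =
  \sum_(a < n) block_sum a (n - a.+1) +
  \sum_(a < n) \sum_(b < n - a.+1) chain_sum a b (n - a.+1 - b.+1).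
Proof.
under eq_bigr => K _ do rewrite count_lowE //.
rewrite exchange_big -big_split; apply: eq_bigr => a _ /=.
have an : n - a.+1 < n by have := ltn_ord a; lia.
rewrite /block_sum -(sum_nrgf_trunc (fun k => 'C(a + k, k)) an).
have -> : \sum_(b < n - a.+1) chain_sum a b (n - a.+1 - b.+1) = \sum_(b < n - a.+1)
   \sum_(K < n) (\sum_(i < K.+1) weak_comp a (K - i) * i.+2 ^ b) * nrgf (n - a.+1 - b.+1) K.
  apply: eq_bigr => b _; have bn : n - a.+1 - b.+1 < n by lia.
  by rewrite (sum_nrgf_trunc (fun K => \sum_(i < K.+1) weak_comp a (K - i) * i.+2 ^ b) bn).
rewrite exchange_big -big_split; apply: eq_bigr => K _ /=.
under eq_bigr => e _ do rewrite mulnDr.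
rewrite big_split -big_distrl sum_weak_comp /=; congr (_ + _); first by rewrite /weak_comp addnC.
rewrite (eq_bigr (fun e : 'I_K.+1 => \sum_(b < n - a.+1)
     weak_comp a (K - e) * e.+2 ^ b * nrgf (n - a.+1 - b.+1) K)); last first.
  move=> e _; have eK : e <= K by rewrite -ltnS.
  by rewrite count_highE // big_distrr; apply: eq_bigr => b _; rewrite /= mulnA.
by rewrite exchange_big; apply: eq_bigr => b _; rewrite big_distrl.
Qed.

Lemma sum_triangle m (F : nat -> nat -> nat) :
  \sum_(a < m) \sum_(c < a.+1) F (m - a.+1) c =
  \sum_(a < m) \sum_(x < a.+1) F x (m - a.+1).
Proof.
rewrite (reindex_inj rev_ord_inj) [RHS](reindex_inj rev_ord_inj) /=.
have E (a : 'I_m) : ((m - a.+1).+1 = m - a) * (m - (m - a) = a).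
  by split; have := ltn_ord a; lia.
transitivity (\sum_(x < m) \sum_(c < m) (x + c < m) * F x c).
  apply: eq_bigr => x _; rewrite !E (big_ord_widen _ (F x) (leq_subr x m)) big_mkcond.
  by apply: eq_bigr => c _; rewrite ltn_subRL; case: ifP; rewrite ?mul1n.
rewrite exchange_big; apply: eq_bigr => c _.
rewrite !E (big_ord_widen _ (F^~ c) (leq_subr c m)) [RHS]big_mkcond.
by apply: eq_bigr => x _; rewrite ltn_subRL addnC; case: ifP; rewrite ?mul1n.
Qed.

Lemma sum_pow2 n : (\sum_(a < n) 2 ^ a).+1 = 2 ^ n.
Proof.
by elim: n => [|n IH]; rewrite ?big_ord0 // big_ord_recr -addSn IH expnS mul2n addnn.
Qed.

Lemma hockey a k : \sum_(x < a.+1) 'C(x + k, k) = 'C(k + a + 1, k + 1).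
Proof.
elim: a => [|a IH]; first by rewrite big_ord1 add0n addn0 !binn.
by rewrite big_ord_recr IH /= !addn1 addnS [RHS]binS addSn [a + k]addnC.
Qed.

(** The sums of the closed form for permutations of [n + 2] values: the positive
and the negative part of the triple sum, and the last double sum. *)
Definition chain_total n := \sum_(a < n) \sum_(b < a) chain_sum (n - a.+1) b (a - b).
Definition block_total n := \sum_(a < n) \sum_(b < a) block_sum (n - a.+1) (a - b).
Definition last_total n :=
  \sum_(a < n.+1) \sum_(k < (n - a).+1) 'C(k + a + 1, k + 1) * nrgf (n - a) k.

(** By the hockey-stick identity the right-hand side is the sum of [block_sum x c]
over all [x + c <= n].  On the left are the terms with [x + c = n], those with
[c > 0] among the others, and the [n] remaining terms, which have [c = 0] and
equal 1. *)
Lemma sum_block_total n :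
  \sum_(a < n.+1) block_sum a (n - a) + block_total n + n = last_total n.
Proof.
have -> : last_total n = \sum_(a < n.+1) \sum_(x < a.+1) block_sum x (n - a).
  apply: eq_bigr => a _; rewrite /block_sum exchange_big; apply: eq_bigr => k _ /=.
  by rewrite -big_distrl /= hockey.
under [RHS]eq_bigr => a _ do rewrite big_ord_recr /=.
rewrite big_split /= [RHS]addnC -addnA; congr (_ + _).
rewrite big_ord_recl big_ord0 add0n.
rewrite (eq_bigr (fun a : 'I_n => \sum_(x < a.+1) block_sum x (n - a.+1))); last by [].
have En : \sum_(a < n) 1 = n by rewrite sum_nat_const card_ord muln1.
rewrite -sum_triangle -[Z in _ + Z = _]En /block_total -big_split /=.
apply: eq_bigr => a _; rewrite [RHS]big_ord_recl block_sum0 addnC; congr (_ + _).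
rewrite (reindex_inj rev_ord_inj); apply: eq_bigr => b _ /=.
by congr block_sum; rewrite /bump; have := ltn_ord b; lia.
Qed.

(** The powers of 2 are the terms without values above the record with label [K],
which is then the largest value and has label 0. *)
Lemma sum_chain_split n :
  \sum_(a < n.+1) \sum_(b < n.+1 - a.+1) chain_sum a b (n.+1 - a.+1 - b.+1) =
  chain_total n + \sum_(a < n) 2 ^ a.
Proof.
rewrite big_ord_recr /= subnn big_ord0 addn0 /chain_total -big_split /=.
rewrite (reindex_inj rev_ord_inj); apply: eq_bigr => a _ /=.
have -> : n.+1 - (n - a.+1).+1 = a.+1 by have := ltn_ord a; lia.
by rewrite big_ord_recr /= subnn chain_sum0; congr (_ + _).
Qed.

Lemma count_avoiders n : #|[set pi : 'S_n.+2 | avoids_bar1_43_bar5_2 pi]| + 1 =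
  bell n.+1 + \sum_(a < n.+1) block_sum a (n - a) + chain_total n + 2 ^ n.
Proof.
have -> : #|[set pi : 'S_n.+2 | avoids_bar1_43_bar5_2 pi]| = \sum_(w <- rgf n.+2) word_ok w.
  rewrite -(sum_separated n.+2 (fun w => word_ok w : nat)) -sum1dep_card.
  rewrite big_mkcond [RHS]big_mkcond.
  by apply: eq_bigr => s _; rewrite avoids_word_ok; case: (separated s); case: word_ok.
rewrite sum_word_ok sum_count_low sum_chain_split -bellE -(sum_pow2 n) -!addnA !addn1.
by [].
Qed.

Import GRing.Theory.
Local Open Scope ring_scope.

Lemma binz_nat (N j : nat) : binz N%:Z j = 'C(N, j)%:Z.
Proof.
rewrite /binz big_mkord; have -> : \prod_(l < j) (N%:Z - l%:Z) = (N ^_ j)%:Z.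
  have [jN|Nj] := leqP j N.
    rewrite ffact_prod (big_morph Posz PoszM (erefl _)); apply: eq_bigr => l _.
    by rewrite subzn // ltnW // (leq_trans (ltn_ord l)).
  by rewrite ffact_small // (bigD1 (Ordinal Nj)) //= subrr mul0r.
by rewrite -bin_ffact PoszM mulzK // -lt0n fact_gt0.
Qed.

(** For [a = 0] and [e > 0] the product contains the factor 0, and for
[a = e = 0] it is empty. *)
Lemma binz_weak_comp a e : binz (a%:Z + e%:Z - 1) e = (weak_comp a e)%:Z.
Proof.
case: a => [|a]; last by rewrite (_ : _ - 1 = (e + a)%N%:Z) ?binz_nat //; lia.
case: e => [|e]; first by rewrite /binz big_nil.
rewrite (_ : _ - 1 = e%:Z) ?binz_nat ?bin_small //; lia.
Qed.

Lemma PoszX m k : (m ^ k)%N%:Z = m%:Z ^+ k.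
Proof. by elim: k => // k IH; rewrite expnS exprS PoszM IH. Qed.

Lemma Posz_sum n (F : nat -> nat) : (\sum_(i < n) F i)%N%:Z = \sum_(0 <= i < n) (F i)%:Z.
Proof. by rewrite (big_morph Posz PoszD (erefl _)) big_mkord. Qed.

Theorem mainTheorem1 (n : nat) (hn : (2 <= n)%N) :
  (#|[set pi : 'S_n | avoids_bar1_43_bar5_2 pi]|)%:Z =
    (bell (n - 1))%:Z + 1 + 2 ^+ (n - 2) - n%:Z
    + \sum_(0 <= a < n - 2) \sum_(0 <= b < a) \sum_(0 <= k < (a - b).+1)
        (\sum_(0 <= i < k.+1)
            binz (n%:Z - 4 - a%:Z + k%:Z - i%:Z) (k - i) * (i%:Z + 2) ^+ b
         - binz (n%:Z - 3 - a%:Z + k%:Z) k) * (stirling2 (a - b) k)%:Z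
    + \sum_(0 <= a < n - 1) \sum_(0 <= k < (n - 2 - a).+1)
        binz (k%:Z + a%:Z + 1) (k + 1) * (stirling2 (n - 2 - a) k)%:Z.
Proof.
case: n hn => [|[|n]] // _.
have [-> ->] : (n.+2 - 1 = n.+1)%N /\ (n.+2 - 2 = n)%N by lia.
have -> : \sum_(0 <= a < n.+1) \sum_(0 <= k < (n - a).+1)
        binz (k%:Z + a%:Z + 1) (k + 1) * (stirling2 (n - a) k)%:Z = (last_total n)%:Z.
  rewrite /last_total (Posz_sum _ (fun a =>
    \sum_(k < (n - a).+1) 'C(k + a + 1, k + 1) * nrgf (n - a) k)%N).
  apply: eq_bigr => a _.
  rewrite (Posz_sum _ (fun k => 'C(k + a + 1, k + 1) * nrgf (n - a) k)%N).
  apply: eq_bigr => k _; rewrite stirling2E PoszM; congr (_ * _).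
  by rewrite -binz_nat !PoszD.
have -> : \sum_(0 <= a < n) \sum_(0 <= b < a) \sum_(0 <= k < (a - b).+1)
        (\sum_(0 <= i < k.+1)
            binz (n.+2%:Z - 4 - a%:Z + k%:Z - i%:Z) (k - i) * (i%:Z + 2) ^+ b
         - binz (n.+2%:Z - 3 - a%:Z + k%:Z) k) * (stirling2 (a - b) k)%:Z
    = (chain_total n)%:Z - (block_total n)%:Z.
  rewrite /chain_total (Posz_sum _ (fun a => \sum_(b < a) chain_sum (n - a.+1) b (a - b))%N).
  rewrite /block_total (Posz_sum _ (fun a => \sum_(b < a) block_sum (n - a.+1) (a - b))%N) -sumrB.
  rewrite !big_nat; apply: eq_bigr => a /= an.
  rewrite (Posz_sum _ (fun b => chain_sum (n - a.+1) b (a - b)%N)).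
  rewrite (Posz_sum _ (fun b => block_sum (n - a.+1) (a - b)%N)) -sumrB.
  apply: eq_bigr => b _.
  rewrite /chain_sum (Posz_sum _ (fun k =>
    (\sum_(i < k.+1) weak_comp (n - a.+1) (k - i) * i.+2 ^ b) * nrgf (a - b) k)%N).
  rewrite /block_sum (Posz_sum _ (fun k => 'C(n - a.+1 + k, k) * nrgf (a - b) k)%N) -sumrB.
  apply: eq_bigr => k _; rewrite !PoszM -mulrBl stirling2E; congr ((_ - _) * _); last first.
    by rewrite -binz_nat; congr binz; lia.
  rewrite (Posz_sum _ (fun i => weak_comp (n - a.+1) (k - i) * i.+2 ^ b)%N).
  rewrite !big_nat; apply: eq_bigr => i /= ik.
  rewrite PoszM -binz_weak_comp PoszX; congr (binz _ _ * _ ^+ _); lia.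
have := count_avoiders n; have := sum_block_total n.
rewrite -(PoszX 2 n); lia.
Qed.
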